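(* Let $K=\mathbb{C}_p$. For any ball system $(\mathcal{B},\tau,\mathcal{B}')$ in $K$, there exists a rational function $\phi\in K(z)$ that interprets $\tau$ with inclusion.
   Context: For $a\in K$, $r>0$, $B(a,r)=\{z\in K:|z-a|\le r\}$ is the closed ball. A ball system is a triple $(\mathcal{B},\tau,\mathcal{B}')$ where $\mathcal{B}=\{B_i=B(a_i,r_i)\}_{i=1}^N$ is a finite collection of pairwise disjoint closed balls, $\tau:\{1,\dots,N\}\to\{1,\dots,N\}$ is a map, and $\mathcal{B}'=\{B_i'=B(b_i,t_i)\}_{i=1}^N$ is a family of closed balls. A map $\phi$, analytic in a neighborhood of $U=\bigcup_i B_i$ (for rational $\phi$: with no poles on some open neighborhood of $U$), interprets $\tau$ with inclusion if $\phi(B_i)\subseteq B'_{\tau(i)}$ for all $i$. *)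

(* Defs.v *)
From HB Require Import structures.
From mathcomp Require Import all_boot all_order all_algebra.
From mathcomp Require Import generic_quotient fraction.
From mathcomp Require Import boolp classical_sets functions reals topology.

Set Implicit Arguments.
Unset Strict Implicit.
Unset Printing Implicit Defensive.

Import Order.TTheory GRing.Theory Num.Theory.

Local Open Scope quotient_scope.
Local Open Scope classical_set_scope.
Local Open Scope ring_scope.

(* MathComp's norms satisfy [`|x *+ n| = `|x| *+ n], which no
   non-archimedean absolute value does, hence a separate structure. *)
HB.mixin Record Field_isUltrametric (R : realType) K & GRing.Field K := {
  vabs : K -> R;
  vabs_ge0 : forall x : K, 0 <= vabs x;
  vabs_eq0 : forall x : K, (vabs x == 0) = (x == 0);
  vabsM : forall x y : K, vabs (x * y) = vabs x * vabs y;
  vabsD : forall x y : K, vabs (x + y) <= Num.max (vabs x) (vabs y)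
}.

#[short(type="ultrametricFieldType")]
HB.structure Definition UltrametricField (R : realType) :=
  { K of GRing.Field K & Field_isUltrametric R K }.

(* [K] as a metric space for the distance [vabs (x - y)]; an alias, because
   the library has no join of the field and the metric structures. *)
Definition metric_of (R : realType) (K : ultrametricFieldType R) : Type := K.

Section MetricOf.
Variables (R : realType) (K : ultrametricFieldType R).

Let dist (x y : K) : R := vabs (x - y).

Let distxx x : dist x x = 0.
Proof. by apply/eqP; rewrite /dist subrr vabs_eq0. Qed.

Let dist_positivity x y : dist x y = 0 -> x = y.
Proof. by move/eqP; rewrite /dist vabs_eq0 subr_eq0 => /eqP. Qed.

Let dist_sym x y : dist x y = dist y x.
Proof.
have vabsN1 : vabs (-1 : K) = 1 :> R.
  have v1 : vabs (1 : K) = 1 :> R.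
    have : vabs (1 : K) != 0 :> R by rewrite vabs_eq0 oner_eq0.
    by move/mulfI; apply; rewrite -vabsM !mulr1.
  apply/eqP; rewrite -(@eqrXn2 _ 2%N) ?vabs_ge0 ?ler01 // expr1n expr2.
  by rewrite -vabsM mulrNN mulr1 v1.
by rewrite /dist -opprB -mulN1r vabsM vabsN1 mul1r.
Qed.

Let dist_triangle y x z : dist x z <= dist x y + dist y z.
Proof.
rewrite /dist -(subrKA y x (- z)); apply: le_trans (vabsD _ _) _.
by rewrite ge_max lerDl lerDr !vabs_ge0.
Qed.

HB.instance Definition _ := Choice.copy (metric_of K) K.
HB.instance Definition _ := isPointed.Build (metric_of K) (0 : K).
HB.instance Definition _ :=
  isMetric.Build R (metric_of K) distxx dist_positivity dist_sym dist_triangle.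

End MetricOf.

Definition padic_abs (R : realType) (p : nat) (x : rat) : R :=
  if x == 0 then 0
  else p%:R ^ ((logn p `|denq x|)%:Z - (logn p `|numq x|)%:Z).

Definition complete_space (T : puniformType) : Prop :=
  forall F : set_system T, ProperFilter F -> cauchy F -> cvg F.

(* [j : F -> E] exhibits [E] as a completion of [F] for the absolute value
   [absF]; [absF] is a bare function because [rat] already carries its usual
   archimedean norm. *)
Definition is_completion (R : realType) (F : fieldType) (absF : F -> R)
    (E : ultrametricFieldType R) (j : {rmorphism F -> E}) : Prop :=
  [/\ forall x : F, vabs (j x) = absF x,
      dense (range j : set (metric_of E))
    & complete_space (metric_of E)].

Definition is_algebraic_closure (F E : fieldType) (j : {rmorphism F -> E})
    : Prop :=
  GRing.closed_field_axiom E /\ forall x : E, algebraicOver j x.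

(* [K] is a copy of the field of p-adic complex numbers: the completion of an
   algebraic closure [Qpbar], with the absolute value extending that of [Qp],
   of the completion [Qp] of the rationals at [p]. *)
Definition is_Cp (R : realType) (p : nat) (K : ultrametricFieldType R) : Prop :=
  exists (Qp Qpbar : ultrametricFieldType R)
    (i : {rmorphism rat -> Qp}) (j : {rmorphism Qp -> Qpbar})
    (k : {rmorphism Qpbar -> K}),
  [/\ is_completion (@padic_abs R p) i,
      is_algebraic_closure j,
      forall x : Qp, vabs (j x) = vabs x :> R
    & is_completion (@vabs R Qpbar) k].

Definition cball (R : realType) (K : ultrametricFieldType R) (a : K) (r : R)
    : set K :=
  [set z | vabs (z - a) <= r].

Record ball_system (R : realType) (K : ultrametricFieldType R) := BallSystem {
  bs_size : nat;
  bs_center : 'I_bs_size -> K;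
  bs_radius : 'I_bs_size -> R;
  bs_radius_gt0 : forall i, 0 < bs_radius i;
  bs_disjoint : forall i j, i != j ->
    cball (bs_center i) (bs_radius i) `&` cball (bs_center j) (bs_radius j)
      = set0;
  bs_map : 'I_bs_size -> 'I_bs_size;
  bs_center' : 'I_bs_size -> K;
  bs_radius' : 'I_bs_size -> R;
  bs_radius'_gt0 : forall i, 0 < bs_radius' i
}.

Section BallSystem.
Variables (R : realType) (K : ultrametricFieldType R) (S : ball_system K).

Definition bs_ball (i : 'I_(bs_size S)) : set K :=
  cball (bs_center i) (bs_radius i).

Definition bs_ball' (i : 'I_(bs_size S)) : set K :=
  cball (bs_center' i) (bs_radius' i).

Definition bs_union : set K := \bigcup_(i in [set: 'I_(bs_size S)]) bs_ball i.

End BallSystem.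

Section RationalFunctions.
Variable K : fieldType.
Implicit Types (phi : {fraction {poly K}}) (x : K).

(* Numerator and denominator in lowest terms. *)
Definition ratnum phi : {poly K} :=
  let f := repr phi in \n_f %/ gcdp \n_f \d_f.
Definition ratden phi : {poly K} :=
  let f := repr phi in \d_f %/ gcdp \n_f \d_f.

Definition is_pole phi x : Prop := root (ratden phi) x.

(* Only meaningful when [x] is not a pole of [phi]. *)
Definition rateval phi x : K := (ratnum phi).[x] / (ratden phi).[x].

Lemma rateval_frac (p q : {poly K}) x : q.[x] != 0 ->
  let phi := FracField.tofrac p / FracField.tofrac q in
  ~ is_pole phi x /\ rateval phi x = p.[x] / q.[x].
Proof.
move=> qx0 phi; have q0 : q != 0.
  by apply: contraNneq qx0 => ->; rewrite horner0.
set f := repr phi; set n := \n_f; set d := \d_f.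
have d0 : d != 0 by exact: denom_ratioP.
have phiE : phi = \pi_({fraction {poly K}}) (Ratio p q).
  apply: (canLR (mulfK _)); first by rewrite tofrac_eq0.
  rewrite !piE; apply/eqmodP.
  rewrite /= FracField.equivfE /FracField.mulf.
  by rewrite !numden_Ratio ?mulr1 ?oner_eq0 // mul1r.
have nq : n * q = d * p.
  have := FracField.equivf_l (Ratio p q).
  by rewrite -/FracField.type -phiE numer_Ratio // denom_Ratio.
rewrite /is_pole /rateval /ratnum /ratden -/f -/n -/d.
set g := gcdp n d; have g0 : g != 0 by rewrite gcdp_eq0 (negPf d0) andbF.
have nE : n = n %/ g * g by rewrite divpK // dvdp_gcdl.
have dE : d = d %/ g * g by rewrite divpK // dvdp_gcdr.
have cop : coprimep (d %/ g) (n %/ g).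
  by rewrite coprimep_sym; apply: coprimep_div_gcd; rewrite d0 orbT.
have nq' : n %/ g * q = d %/ g * p.
  by apply: (mulIf g0); rewrite mulrAC -nE nq {1}dE mulrAC.
have dx0 : (d %/ g).[x] != 0.
  have : d %/ g %| q by rewrite -(Gauss_dvdpr _ cop) nq' dvdp_mulr.
  by case/dvdpP=> u qE; apply: contraNneq qx0 => dx; rewrite qE hornerM dx mulr0.
split; first exact/negP.
by apply/eqP; rewrite eqr_div // -!hornerM nq' mulrC.
Qed.

End RationalFunctions.

Definition interprets_with_inclusion (R : realType)
    (K : ultrametricFieldType R) (S : ball_system K)
    (phi : {fraction {poly K}}) : Prop :=
  (exists V : set (metric_of K),
     [/\ open V, bs_union S `<=` V & forall x, V x -> ~ is_pole phi x])
  /\ forall i : 'I_(bs_size S),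
       [set rateval phi x | x in bs_ball i] `<=` bs_ball' (bs_map i).

(* Main.v *)
Require Import Defs.
From HB Require Import structures.
From mathcomp Require Import all_boot all_order all_algebra.
From mathcomp Require Import generic_quotient fraction.
From mathcomp Require Import boolp classical_sets functions reals topology.
From mathcomp Require Import normedtype sequences.

(** For a scale [c] and a center [a], the rational function
      h(z) = 1 / (1 - ((z - a) / c)^n)
    approximates, for large [n], the indicator of the disc |z - a| < |c|:
    it is close to 1 where |z - a| < |c| and close to 0 where |z - a| > |c|.
    Both approximations are uniform on any ball that stays away from the
    circle |z - a| = |c| ([near_cutoff_inside], [near_cutoff_outside]).

    In an ultrametric field two disjoint balls satisfy r_i < |a_j - a_i|, and
    every z in B_j has |z - a_i| = |a_j - a_i|.  A scale c_i with
    r_i < |c_i| < |a_j - a_i| for all j <> i thus makes the cutoff h_i at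
    (a_i, c_i) an approximate indicator of B_i among the finitely many given
    balls, and
      phi = sum_i b_(tau i) h_i
    is, on each B_j, as close to b_(tau j) as desired; since errors do not
    accumulate in ultrametric sums, it suffices that each of the finitely many
    terms be within t_(tau j).  No denominator vanishes on the union of the
    balls, which is open, so it serves as its own pole-free neighborhood.

    The scales c_i exist because the absolute value of C_p takes a dense set
    of values: |p| = 1/p < 1 and the algebraic closure of Q_p inside C_p
    contains m-th roots of p for all m, whose absolute values tend to 1
    ([dense_values_of_roots], [is_Cp_dense_values]). *)

Section InterpretationWithInclusion.
Set Implicit Arguments.
Unset Strict Implicit.
Import Order.TTheory GRing.Theory Num.Theory.
Import numFieldNormedType.Exports.
Local Open Scope classical_set_scope.
Local Open Scope ring_scope.

(** * Ultrametric absolute values *)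

Section UltrametricAbs.
Variables (R : realType) (K : ultrametricFieldType R).
Implicit Types x y w : K.

Lemma vabs0 : vabs (0 : K) = 0 :> R.
Proof. by apply/eqP; rewrite vabs_eq0. Qed.

Lemma vabs1 : vabs (1 : K) = 1 :> R.
Proof.
have : vabs (1 : K) != 0 :> R by rewrite vabs_eq0 oner_eq0.
by move/mulfI; apply; rewrite -vabsM !mulr1.
Qed.

Lemma vabs_gt0 x : (0 < vabs x :> R) = (x != 0).
Proof. by rewrite lt0r vabs_ge0 andbT vabs_eq0. Qed.

Lemma vabsN x : vabs (- x) = vabs x :> R.
Proof.
apply/eqP; rewrite -(@eqrXn2 _ 2%N) ?vabs_ge0 //.
by rewrite !expr2 -!vabsM mulrNN.
Qed.

Lemma vabsB_sym x y : vabs (x - y) = vabs (y - x) :> R.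
Proof. by rewrite -vabsN opprB. Qed.

Lemma vabsX x n : vabs (x ^+ n) = vabs x ^+ n :> R.
Proof.
by elim: n => [|n IHn]; rewrite ?expr0 ?vabs1 // !exprS vabsM IHn.
Qed.

Lemma vabsV x : vabs x^-1 = (vabs x)^-1 :> R.
Proof.
have [->|x0] := eqVneq x 0; first by rewrite invr0 vabs0 invr0.
apply: (mulfI (x := vabs x)); first by rewrite vabs_eq0.
by rewrite -vabsM !divff ?vabs_eq0 ?vabs1.
Qed.

Lemma vabs_sum_le (I : finType) (F : I -> K) (t : R) : 0 <= t ->
  (forall i, vabs (F i) <= t) -> vabs (\sum_i F i) <= t.
Proof.
move=> t0 Ft; elim/big_ind: _ => [|x y xt yt|//]; first by rewrite vabs0.
by apply: le_trans (vabsD x y) _; rewrite ge_max xt yt.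
Qed.

(** Isosceles triangles: otherwise [y = (x + y) - x] would be too small. *)
Lemma vabsD_eqr x y : vabs x < vabs y :> R -> vabs (x + y) = vabs y :> R.
Proof.
move=> xy; apply/le_anti/andP; split.
  by apply: le_trans (vabsD x y) _; rewrite ge_max (ltW xy) lexx.
have := vabsD (x + y) (- x); rewrite addrAC subrr add0r vabsN le_max.
by rewrite [X in _ || X]leNgt xy orbF.
Qed.

(** The denominator has absolute value 1, and the difference is
    [w ^+ n / (1 - w ^+ n)]. *)
Lemma cutoff_inside w n : vabs w < 1 :> R -> (0 < n)%N ->
  1 - w ^+ n != 0 /\ vabs ((1 - w ^+ n)^-1 - 1) = vabs w ^+ n :> R.
Proof.
move=> w1 n0.
have v1 : vabs (1 - w ^+ n) = 1 :> R.
  by rewrite addrC vabsD_eqr vabs1 // vabsN vabsX exprn_ilt1 ?vabs_ge0 // -lt0n.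
have nz : 1 - w ^+ n != 0 by rewrite -vabs_gt0 v1.
split=> //; rewrite -{2}(mulVf nz) -{1}[_^-1]mulr1 -mulrBr vabsM vabsV v1.
by rewrite invr1 mul1r opprB addrC subrK vabsX.
Qed.

(** Here [w ^+ n] dominates 1 in the denominator. *)
Lemma cutoff_outside w n : 1 < vabs w :> R -> (0 < n)%N ->
  1 - w ^+ n != 0 /\ vabs (1 - w ^+ n)^-1 = (vabs w)^-1 ^+ n :> R.
Proof.
move=> w1 n0.
have v : vabs (1 - w ^+ n) = vabs w ^+ n :> R.
  by rewrite vabsD_eqr vabsN vabsX // vabs1 exprn_egt1 // -lt0n.
split; last by rewrite vabsV v exprVn.
by rewrite -vabs_gt0 v exprn_gt0 // (lt_trans ltr01).
Qed.

(** A closed ball of radius [r] contains the open ball of radius [r] around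
    each of its points. *)
Lemma open_cball (a : K) (r : R) : 0 < r ->
  open (cball a r : set (metric_of K)).
Proof.
move=> r0; rewrite openE => x xr; apply/nbhs_ballP; exists r => //= y xy.
rewrite /cball /= -(subrKA x) addrC.
apply: le_trans (vabsD _ _) _; rewrite ge_max xr andTb.
by rewrite vabsB_sym; apply: ltW.
Qed.

Definition dense_values := forall r d : R, 0 < r -> r < d ->
  exists c : K, r < vabs c < d.

End UltrametricAbs.

(** * Density of the value group *)

Lemma near_geometric (R : realType) (q M t : R) : 0 <= q < 1 -> 0 < t ->
  \forall n \near \oo, M * q ^+ n < t.
Proof.
move=> /andP[q0 q1] t0.
have : (fun n => M * q ^+ n) @ \oo --> M * 0.
  by apply: cvgMl_tmp; apply: cvg_expr; rewrite ger0_norm.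
by move/cvgr_lt; apply; rewrite mulr0.
Qed.

(** For large [m], an [m]-th root [u] of [x] has [|u|] close to 1, so that the
    consecutive powers of [u] have absolute values in ratio less than [d / r]
    and cannot jump over the interval from [r] to [d]. *)
Lemma dense_values_of_roots (R : realType) (K : ultrametricFieldType R)
    (x : K) : x != 0 -> vabs x < 1 :> R ->
  (forall n, (0 < n)%N -> exists u : K, u ^+ n = x) -> dense_values K.
Proof.
move=> x0 x1 rootx r d r0 rd; have d0 := lt_trans r0 rd.
have s01 : 0 <= r / d < 1.
  by rewrite divr_ge0 ?(ltW r0) ?(ltW d0) // ltr_pdivrMr // mul1r.
have s0 : 0 <= r / d by case/andP: s01.
have xgt0 : 0 < vabs x :> R by rewrite vabs_gt0.
near \oo => m.
have m0 : (0 < m)%N by near: m; exact: nbhs_infty_gt.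
have sm : 1 * (r / d) ^+ m < vabs x by near: m; exact: near_geometric.
have [u um] := rootx m m0.
have su : r / d < vabs u.
  rewrite -(@ltr_pXn2r _ m) ?nnegrE ?vabs_ge0 ?s0 //.
  by rewrite -vabsX um -[X in X < _]mul1r.
have u0 : 0 < vabs u :> R by exact: le_lt_trans su.
have u1 : vabs u < 1 :> R.
  rewrite -(@ltr_pXn2r _ m) ?nnegrE ?vabs_ge0 ?ler01 //.
  by rewrite expr1n -vabsX um.
have u01 : 0 <= (vabs u : R) < 1 by rewrite (ltW u0) u1.
(* Dividing by [u ^+ l] makes the sequence of powers start above [d]. *)
near \oo => l.
have dl : d * vabs u ^+ l < 1 by near: l; exact: near_geometric.
have ex : exists n, (vabs u ^+ l)^-1 * vabs u ^+ n < d.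
  near \oo => n; exists n; near: n; exact: near_geometric.
have ul0 : 0 < vabs u ^+ l by rewrite exprn_gt0.
(* The first power of absolute value less than [d] is the one wanted: its
   predecessor is at least [d], and [d * |u| > r]. *)
case: (ex_minnP ex) => -[|n] nd nmin.
  by move: nd; rewrite expr0 mulr1 ltNge -div1r ler_pdivlMr // ltW.
exists (u ^- l * u ^+ n.+1); rewrite vabsM vabsV !vabsX nd andbT.
have dn : d <= (vabs u ^+ l)^-1 * vabs u ^+ n.
  by rewrite leNgt; apply/negP => /nmin; rewrite ltnn.
rewrite exprSr mulrA; apply: lt_le_trans (_ : r < d * vabs u) _.
  by rewrite mulrC -ltr_pdivrMr.
by rewrite ler_wpM2r ?vabs_ge0.
Unshelve. all: by end_near.
Qed.

(** The element whose roots are used is the image of [p]; its roots already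
    exist in the algebraic closure of [Qp]. *)
Lemma is_Cp_dense_values (R : realType) (p : nat)
    (K : ultrametricFieldType R) : prime p -> is_Cp p K -> dense_values K.
Proof.
move=> p_prime [Qp [Qpbar [i [j [k [[iabs _ _] [closed _] jabs [kabs _ _]]]]]]].
have p0 : p%:R != 0 :> rat by rewrite pnatr_eq0 -lt0n prime_gt0.
apply: (@dense_values_of_roots R K (k (j (i p%:R)))).
- by rewrite !fmorph_eq0.
- rewrite kabs jabs iabs /padic_abs (negPf p0).
  rewrite (pmulrn (1 : rat) p) numq_int denq_int /= logn1 logn_prime // eqxx.
  by rewrite sub0r exprN1 invf_lt1 ?ltr1n ?ltr0n ?prime_gt1 ?prime_gt0.
move=> n n0.
(* The axiom of closed fields, for the monic equation [y ^+ n = p]. *)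
have [y] := closed n (fun l => if l == 0%N then j (i p%:R) else 0) n0.
rewrite -(prednK n0) big_ord_recl big1 /= ?expr0 ?mulr1 ?addr0 => [yn|l _].
  by exists (k y); rewrite -rmorphXn yn.
by rewrite mul0r.
Qed.

(** * Rational cutoff functions *)

(** Evaluation is defined through a representation in lowest terms, so the sum
    is put over the common denominator [\prod_i Q i], from which it can be
    evaluated by [rateval_frac]. *)
Lemma rational_sum_of_inverses (K : fieldType) (I : finType)
    (b : I -> K) (Q : I -> {poly K}) :
  exists phi : {fraction {poly K}}, forall x, (forall i, (Q i).[x] != 0) ->
    ~ is_pole phi x /\ rateval phi x = \sum_i b i / (Q i).[x].
Proof.
pose num := \sum_i b i *: \prod_(j | j != i) Q j.
exists (FracField.tofrac num / FracField.tofrac (\prod_i Q i)) => x Qx.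
have Px : (\prod_i Q i).[x] != 0 by rewrite horner_prod; apply/prodf_neq0.
have [npole ->] := rateval_frac num Px; split=> //.
apply: (canLR (mulfK Px)); rewrite mulr_suml horner_sum.
apply: eq_bigr => i _; rewrite hornerZ !horner_prod [in RHS](bigD1 i) //=.
by rewrite mulrA divfK.
Qed.

Section Cutoff.
Variables (R : realType) (K : ultrametricFieldType R).
Variables (a c b : K) (t : R).
Hypothesis t0 : 0 < t.

(** The cutoff tends to 1 uniformly where [|z - a| <= r], at the geometric rate
    [r / |c|]; the factor [b] is the value it is meant to select. *)
Lemma near_cutoff_inside (r : R) : 0 <= r < vabs c ->
  \forall n \near \oo, forall z, vabs (z - a) <= r ->
    1 - ((z - a) / c) ^+ n != 0 /\
    vabs (b * ((1 - ((z - a) / c) ^+ n)^-1 - 1)) <= t.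
Proof.
move=> /andP[r0 rc]; have c0 := le_lt_trans r0 rc.
have q0 : 0 <= r / vabs c by rewrite divr_ge0 ?vabs_ge0.
have q1 : r / vabs c < 1 by rewrite ltr_pdivrMr // mul1r.
near=> n => z zr.
have n0 : (0 < n)%N by near: n; exact: nbhs_infty_gt.
have bt : vabs b * (r / vabs c) ^+ n < t.
  by near: n; apply: near_geometric; rewrite // q0.
have wr : vabs ((z - a) / c) <= r / vabs c :> R.
  by rewrite vabsM vabsV ler_pM2r ?invr_gt0.
have [|nz hz] := @cutoff_inside R K ((z - a) / c) n _ n0.
  exact: le_lt_trans wr q1.
split=> //; rewrite vabsM hz; apply: le_trans (ltW bt).
by rewrite ler_wpM2l ?vabs_ge0 // lerXn2r ?nnegrE ?vabs_ge0.
Unshelve. all: by end_near.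
Qed.

(** On the circle [|z - a| = d] the cutoff tends to 0 at the rate [|c| / d]. *)
Lemma near_cutoff_outside (d : R) : 0 < vabs c < d ->
  \forall n \near \oo, forall z, vabs (z - a) = d ->
    1 - ((z - a) / c) ^+ n != 0 /\
    vabs (b / (1 - ((z - a) / c) ^+ n)) <= t.
Proof.
move=> /andP[c0 cd]; have d0 := lt_trans c0 cd.
have q1 : 0 <= vabs c / d < 1.
  by rewrite divr_ge0 ?vabs_ge0 ?(ltW d0) // ltr_pdivrMr // mul1r.
near=> n => z zd.
have n0 : (0 < n)%N by near: n; exact: nbhs_infty_gt.
have bt : vabs b * (vabs c / d) ^+ n < t by near: n; exact: near_geometric.
have wd : vabs ((z - a) / c) = d / vabs c :> R by rewrite vabsM vabsV zd.
have [|nz hz] := @cutoff_outside R K ((z - a) / c) n _ n0.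
  by rewrite wd ltr_pdivlMr // mul1r.
by split=> //; rewrite vabsM hz wd invf_div ltW.
Unshelve. all: by end_near.
Qed.

End Cutoff.

(** * Interpolation on a ball system *)

Section Interpolation.
Variables (R : realType) (K : ultrametricFieldType R) (S : ball_system K).
Local Notation I := 'I_(bs_size S).
Local Notation a := (@bs_center R K S).
Local Notation r := (@bs_radius R K S).

(** Otherwise [a j] would lie in both balls. *)
Lemma radius_lt_center_dist (i j : I) : i != j -> r i < vabs (a j - a i).
Proof.
move=> ij; rewrite ltNge; apply/negP => ji.
have : (cball (a i) (r i) `&` cball (a j) (r j)) (a j).
  by split; rewrite /cball //= subrr vabs0 ltW // bs_radius_gt0.
by rewrite bs_disjoint.
Qed.

(** Seen from [a i], the ball [B_j] lies on a single circle: its radius is less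
    than the distance between the centers. *)
Lemma vabs_sub_center (i j : I) z : i != j -> bs_ball j z ->
  vabs (z - a i) = vabs (a j - a i) :> R.
Proof.
move=> ij zj; rewrite -(subrKA (a j) z); apply: vabsD_eqr; apply: le_lt_trans zj _.
by rewrite vabsB_sym radius_lt_center_dist // eq_sym.
Qed.

(** The circle of radius [|c|] around [a i] separates [B_i] from all the other
    balls. *)
Lemma separating_scale : dense_values K -> forall i : I, exists c : K,
  r i < vabs c /\ forall j, i != j -> vabs c < vabs (a j - a i) :> R.
Proof.
(* The seed [r i + 1] exceeds [r i] and makes the minimum meaningful when
   there is no other ball. *)
move=> dense i; pose d := \big[Num.min/r i + 1]_(j | i != j) vabs (a j - a i).
have rd : r i < d.
  apply: lt_bigmin => [|j]; first by rewrite ltrDl.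
  exact: radius_lt_center_dist.
have [c /andP[rc cd]] := dense _ _ (bs_radius_gt0 i) rd.
by exists c; split=> // j ij; apply: lt_le_trans cd _; exact: bigmin_le_cond.
Qed.

(** The only arithmetic property of the field that enters is the density of its
    values. *)
Lemma dense_values_interpretation : dense_values K ->
  exists phi : {fraction {poly K}}, interprets_with_inclusion S phi.
Proof.
move=> /separating_scale/choice[c cP].
pose b (i : I) := bs_center' (bs_map i).
pose t (i : I) := bs_radius' (bs_map i).
pose den n (i : I) z := 1 - ((z - a i) / c i) ^+ n.
(* One [n] works for all pairs of balls: on [B_j] the [i]-th cutoff is
   close to the Kronecker symbol of [i] and [j]. *)
have : \forall n \near \oo, forall ij : I * I, forall z, bs_ball ij.2 z ->
    den n ij.1 z != 0 /\
    vabs (b ij.1 * ((den n ij.1 z)^-1 - (ij.1 == ij.2)%:R)) <= t ij.2.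
  apply: filter_forall => -[i j] /=; have [rc cd] := cP i.
  have t0 : 0 < t j by exact: bs_radius'_gt0.
  have r0 := bs_radius_gt0 i.
  have [ji|ij] := eqVneq i j.
    by rewrite -ji in t0 *; apply: near_cutoff_inside; rewrite ?(ltW r0) ?rc.
  have := @near_cutoff_outside R K (a i) (c i) (b i) (t j) t0
    (vabs (a j - a i)).
  rewrite (lt_trans r0 rc) cd // => /(_ isT).
  apply: filterS => n H z zj; rewrite subr0.
  by apply: H; exact: vabs_sub_center.
move=> /filter_ex[n nP].
pose Q i := 1 - ((c i)^-1 *: ('X - (a i)%:P)) ^+ n.
have QE i z : (Q i).[z] = den n i z.
  by rewrite /Q /den !hornerE [_^-1 * _]mulrC.
have [phi phiP] := rational_sum_of_inverses b Q.
have Qn0 (j : I) z : bs_ball j z -> forall i, (Q i).[z] != 0.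
  by move=> zj i; rewrite QE; have [] := nP (i, j) z zj.
exists phi; split.
  exists (bs_union S); split=> //.
    by apply: bigcup_open => i _; apply: open_cball; exact: bs_radius_gt0.
  by move=> z [j _ /Qn0/phiP[]].
move=> j _ [z zj <-]; have [_ ->] := phiP z (Qn0 j z zj).
(* Writing [b j] in the same form reduces the bound to one for each term. *)
have bj : b j = \sum_i b i * (i == j)%:R.
  by rewrite (bigD1 j) //= eqxx mulr1 big1 ?addr0 // => i /negPf->; rewrite mulr0.
rewrite /bs_ball' /cball /= -/(b j) bj -sumrB.
apply: vabs_sum_le => [|i]; first exact/ltW/bs_radius'_gt0.
by rewrite -mulrBr QE; have [] := nP (i, j) z zj.
Qed.

End Interpolation.

End InterpretationWithInclusion.

Theorem corollary5p8 (R : realType) (p : nat) (p_prime : prime p)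
    (K : ultrametricFieldType R) (K_Cp : is_Cp p K) (S : ball_system K) :
  exists phi : {fraction {poly K}}, interprets_with_inclusion S phi.
Proof. exact: dense_values_interpretation (is_Cp_dense_values p_prime K_Cp). Qed.
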